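(* Consider the two-way unsplittable trading problem with known price range $[m,M]$, $0<m<M$, fluctuation ratio $\varphi=M/m$, and at most $k=1$ trade. For every $\epsilon>0$, no deterministic online algorithm has competitive ratio smaller than $\varphi^{1-\epsilon}$; that is, for every deterministic online algorithm there is a price sequence with all prices in $[m,M]$ on which the ratio of the optimal offline return to the algorithm's return is at least $\varphi^{1-\epsilon}$.
   Context: Two-way unsplittable trading problem: a sequence of prices $p(1),p(2),\ldots,p(T)$ (positive reals), one per day, is revealed online; the horizon length $T$ is not known to the online algorithm in advance, but when day $i$ arrives the algorithm learns whether $i=T$. The investor starts with cash and may make at most $k$ trades. A trade is a pair of days $(b,s)$ with $b<s$: on day $b$ all available money is used to buy the stock at price $p(b)$, and on day $s$ all stock held is sold at price $p(s)$. Trades cannot overlap (a sale must happen before the next purchase), there is no short selling, no buying is allowed on the last day $T$, and any stock still held on day $T$ must be sold at price $p(T)$. The gain of a trade $(b,s)$ is $p(s)/p(b)$, and the return of a sequence of trades is the product of their gains (the return is $1$ if no trade is made). The optimal offline algorithm OPT knows the whole sequence and makes at most $k$ trades maximizing the return. The competitive ratio of an online algorithm ONL is the supremum, over all admissible price sequences, of (return of OPT)/(return of ONL). In this model, all prices lie in $[m,M]$ and $m$ and $M$ are known to the online algorithm in advance. *)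

(* Defs.v *)
From mathcomp Require Import all_boot all_order all_algebra.
From mathcomp Require Import all_classical all_reals all_analysis.

Set Implicit Arguments.
Unset Strict Implicit.
Unset Printing Implicit Defensive.

Import Order.TTheory GRing.Theory Num.Theory.

Local Open Scope classical_set_scope.
Local Open Scope ring_scope.

(* Days are numbered from 0, so the last day of p is (size p).-1. A trade is
   a pair (b, s) of a buying day and a selling day. *)
Definition trade : Type := (nat * nat)%type.

(* b < s < T also forbids buying on the last day. *)
Definition feasible (k T : nat) (t : seq trade) : bool :=
  [&& (size t <= k)%N,
      all (fun d : trade => (d.1 < d.2 < T)%N) t
    & sorted (fun d e : trade => (d.2 < e.1)%N) t].

Definition trades_return (R : realType) (p : seq R) (t : seq trade) : R :=
  \prod_(d <- t) (p`_(d.2) / p`_(d.1)).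

Definition opt_return (R : realType) (k : nat) (p : seq R) : R :=
  sup [set trades_return p t | t in [set t | feasible k (size p) t]].

Variant action := Buy | Sell | Wait.

Definition is_buy (a : action) : bool := if a is Buy then true else false.
Definition is_sell (a : action) : bool := if a is Sell then true else false.

(* The arguments are the prices revealed so far, today's included, and whether
   today is the last day. The algorithm being deterministic, its own past
   actions are a function of these. *)
Definition online_algorithm (R : realType) : Type := seq R -> bool -> action.

(* The state is the buying day of the stock held, if any, and the completed
   trades. Inadmissible requests (buying while holding stock, on the last day or
   after k trades; selling without stock) are no-ops; stock held on the last day
   is sold whatever the algorithm answers. *)
Definition online_step (R : realType) (k : nat) (A : online_algorithm R)
    (p : seq R) (st : option nat * seq trade) (i : nat) :
    option nat * seq trade :=
  let last_day := i.+1 == size p in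
  let a := A (take i.+1 p) last_day in
  match st.1 with
  | Some b =>
      if last_day || is_sell a then (None, rcons st.2 (b, i)) else st
  | None =>
      if [&& ~~ last_day, is_buy a & (size st.2 < k)%N]
      then (Some i, st.2) else st
  end.

Definition online_trades (R : realType) (k : nat) (A : online_algorithm R)
    (p : seq R) : seq trade :=
  (foldl (online_step k A p) (None, [::]) (iota 0 (size p))).2.

Definition online_return (R : realType) (k : nat) (A : online_algorithm R)
    (p : seq R) : R :=
  trades_return p (online_trades k A p).

Definition admissible (R : realType) (m M : R) (p : seq R) : bool :=
  (0 < size p)%N && all (fun x => m <= x <= M) p.

Definition competitive_ratio (R : realType) (k : nat) (m M : R)
    (A : online_algorithm R) : \bar R :=
  ereal_sup [set (opt_return k p / online_return k A p)%:E
            | p in [set p | admissible m M p]].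

Lemma online_trades_feasible (R : realType) (k : nat) (A : online_algorithm R)
    (p : seq R) : feasible k (size p) (online_trades k A p).
Proof.
pose inv n (st : option nat * seq trade) :=
  [/\ (size st.2 + st.1 <= k)%N,
      all (fun d : trade => (d.1 < d.2 < n)%N) st.2,
      sorted (fun d e : trade => (d.2 < e.1)%N) st.2
    & forall b, st.1 = Some b ->
        (b < n)%N && all (fun d : trade => (d.2 < b)%N) st.2].
have H n : inv n (foldl (online_step k A p) (None, [::]) (iota 0 n)).
  elim: n => [|n]; first by split.
  rewrite -addn1 iotaD foldl_cat add0n addn1 /=.
  case: (foldl _ _ _) => o t [/= hk ha hs hb].
  have ha' : all (fun d : trade => (d.1 < d.2 < n.+1)%N) t.
    by apply: sub_all ha => d /andP[-> /ltnW].
  rewrite /online_step /=; case: o hk hb => [b|] /= hk hb; case: ifP => hc.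
  - have /andP[bn hall] := hb b erefl.
    split => //=; first by rewrite size_rcons addn0 -addn1.
      by rewrite all_rcons /= bn ltnSn.
    case: t {hk ha ha' hb} hs hall => //= d t hs /andP[h1 h2].
    rewrite rcons_path hs /=.
    have /allP : all (fun e : trade => (e.2 < b)%N) (d :: t) by rewrite /= h1.
    by apply; exact: mem_last.
  - split => //= _ [<-]; have /andP[bn ->] := hb b erefl.
    by rewrite ltnS ltnW.
  - split => //=; first by move: hc => /and3P[_ _]; rewrite addn1.
    by move=> _ [<-]; rewrite ltnSn; apply: sub_all ha => d /andP[].
  - by split.
have [hk ha hs _] := H (size p).
by apply/and3P; split => //; apply: leq_trans hk; rewrite leq_addr.
Qed.

Lemma opt_return_max (R : realType) (k : nat) (p : seq R) :
  exists t, [/\ feasible k (size p) t, opt_return k p = trades_return p t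
    & forall t', feasible k (size p) t' ->
        trades_return p t' <= trades_return p t].
Proof.
pose T := size p.
pose dec (u : k.-tuple (option ('I_T * 'I_T))) : seq trade :=
  [seq (nat_of_ord d.1, nat_of_ord d.2) | d <- pmap id u].
have decP t : feasible k T t -> exists u, dec u = t.
  move=> /and3P[hk ha _].
  pose f (d : trade) : option ('I_T * 'I_T) :=
    if insub d.1 is Some a then
      if insub d.2 is Some b then Some (a, b) else None else None.
  pose s := map f t ++ nseq (k - size t) None.
  have ss : size s == k by rewrite size_cat size_map size_nseq subnKC.
  exists (Tuple ss); rewrite /dec /= /s pmap_cat map_cat.
  have -> : pmap id (nseq (k - size t) (@None ('I_T * 'I_T))) = [::].
    by elim: (k - size t)%N.
  rewrite cats0; elim: t ha {hk s ss} => //= -[a b] t IH /andP[/andP[ab bT] ha].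
  by rewrite /f /= (insubT (fun x => x < T)%N (ltn_trans ab bT))
    (insubT (fun x => x < T)%N bT) /= IH.
pose P (u : k.-tuple (option ('I_T * 'I_T))) := feasible k T (dec u).
have [u0 du0] : exists u, dec u = [::] by apply: decP.
have P0 : P u0 by rewrite /P du0.
have [u Pu umax] :=
  @Order.TotalTheory.arg_maxP _ _ _ u0 P (fun u => trades_return p (dec u)) P0.
have tmax t' : feasible k T t' -> trades_return p t' <= trades_return p (dec u).
  by move=> ft; have [u' du'] := decP _ ft; rewrite -du'; apply: umax; rewrite /P du'.
exists (dec u); split => //; apply/eqP; rewrite eq_le; apply/andP; split.
  apply: ge_sup; first by exists (trades_return p (dec u)), (dec u).
  by move=> _ [t ft <-]; exact: tmax.
apply: ub_le_sup; last by exists (dec u).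
by exists (trades_return p (dec u)) => _ [t ft <-]; exact: tmax.
Qed.

(* Main.v *)
(* The adversary alternates the price M with the prices m phi^(1 - j/n),
   j = 1, ..., n. If the algorithm buys at the j-th low price, the price drops
   to m on the next and last day, a loss of phi^(1 - j/n), while buying at the
   previous low price and selling at M has already gained phi^((j - 1)/n).
   Buying at M loses a factor phi, and never buying misses the gain phi
   available at j = n. *)
Require Import Defs.
From mathcomp Require Import all_boot all_order all_algebra.
From mathcomp Require Import all_classical all_reals all_analysis.
From mathcomp Require Import ring.

Set Implicit Arguments.
Unset Strict Implicit.
Unset Printing Implicit Defensive.

Import Order.TTheory GRing.Theory Num.Theory.

Local Open Scope ring_scope.

Lemma trades_return_le_opt (R : realType) (k : nat) (p : seq R)
    (t : seq trade) :
  feasible k (size p) t -> trades_return p t <= opt_return k p.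
Proof. by have [u [_ -> umax]] := opt_return_max k p; exact: umax. Qed.

Lemma opt_return_ge1 (R : realType) (k : nat) (p : seq R) :
  1 <= opt_return k p.
Proof.
by have := @trades_return_le_opt R k p [::] isT; rewrite /trades_return big_nil.
Qed.

Lemma opt_return_ge_gain (R : realType) (p : seq R) (b s : nat) :
  (b < s < size p)%N -> p`_s / p`_b <= opt_return 1 p.
Proof.
move=> bs; have := @trades_return_le_opt R 1 p [:: (b, s)].
by rewrite /feasible /= bs /trades_return big_seq1; apply.
Qed.

(** Only answers given with the flag [false] matter: a request to buy on the last day is a no-op. *)
Lemma online_state_no_buy (R : realType) (k : nat) (A : online_algorithm R)
    (p : seq R) (n : nat) :
  (forall i, (i < n)%N -> (i.+1 < size p)%N ->
     ~~ is_buy (A (take i.+1 p) false)) ->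
  (n <= size p)%N ->
  foldl (online_step k A p) (None, [::]) (iota 0 n) = (None, [::]).
Proof.
elim: n => [//|n IHn] nobuy ltnp.
rewrite -addn1 iotaD foldl_cat IHn; last by rewrite ltnW.
  rewrite /= add0n /online_step /=; case: ifP => // /and3P[last_n buy_n _].
  have ltSn : (n.+1 < size p)%N by rewrite ltn_neqAle last_n.
  by move: (nobuy n (ltnSn n) ltSn); rewrite -(negbTE last_n) buy_n.
by move=> i /ltnW; exact: nobuy.
Qed.

Lemma online_return_no_buy (R : realType) (k : nat) (A : online_algorithm R)
    (p : seq R) :
  (forall i, (i.+1 < size p)%N -> ~~ is_buy (A (take i.+1 p) false)) ->
  online_return k A p = 1.
Proof.
move=> nobuy; rewrite /online_return /online_trades online_state_no_buy //.
  by rewrite /trades_return big_nil.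
by move=> i _; exact: nobuy.
Qed.

(** The price [y] is in no query of the hypotheses, so the adversary may fix it after seeing the
    purchase at [x]. The forced sale on the last day closes the trade whatever [A] answers. *)
Lemma online_return_buy_penultimate (R : realType) (A : online_algorithm R)
    (s : seq R) (x y : R) :
  (forall i, (i < size s)%N -> ~~ is_buy (A (take i.+1 s) false)) ->
  is_buy (A (rcons s x) false) ->
  online_return 1 A (rcons (rcons s x) y) = y / x.
Proof.
move=> nobuy buy; rewrite /online_return /online_trades.
set p := rcons (rcons s x) y.
have sp : size p = (size s).+2 by rewrite !size_rcons.
have -> : iota 0 (size p) = iota 0 (size s) ++ [:: size s; (size s).+1].
  by rewrite sp -addn2 iotaD.
rewrite foldl_cat online_state_no_buy; last by rewrite sp !leqW.
  have takex : take (size s).+1 p = rcons s x.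
    by rewrite /p -[rcons _ y]cats1 take_cat size_rcons ltnn subnn cats0.
  have xth : p`_(size s) = x.
    by rewrite /p !nth_rcons size_rcons ltnSn ltnn eqxx.
  have yth : p`_(size s).+1 = y.
    by rewrite /p nth_rcons size_rcons ltnn eqxx.
  rewrite /= /online_step /= sp takex eqSS ltn_eqF //= buy /= eqxx /=.
  by rewrite /trades_return big_seq1 /= xth yth.
move=> i lis _; rewrite /p -2!cats1 -catA takel_cat //; exact: nobuy.
Qed.

(** A geometric progression of ratio phi^(-1/n), with phi = [M / m], from [M] at [j = 0] to [m] at
    [j = n]. *)
Definition low_price (R : realType) (m M : R) (n j : nat) : R :=
  m * (M / m) `^ (1 - j%:R / n%:R).

(** Day 2j - 1 carries the [j]-th low price. Index 0 is never offered; it only makes the first low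
    price fit the general computation. *)
Definition zigzag_price (R : realType) (m M : R) (n i : nat) : R :=
  if odd i then low_price m M n (uphalf i) else M.

Lemma ratio_gt1 (R : realType) (m M : R) : 0 < m -> m < M -> 1 < M / m.
Proof. by move=> m_gt0 m_lt_M; rewrite ltr_pdivlMr // mul1r. Qed.

Lemma powR_1B_le (R : realType) (a x : R) :
  1 <= a -> 0 <= x -> a `^ (1 - x) <= a.
Proof.
move=> a1 x0; rewrite -{2}(powRr1 (le_trans ler01 a1)) ler_powR //.
by rewrite gerBl.
Qed.

Lemma low_price0 (R : realType) (m M : R) (n : nat) :
  0 < m -> 0 < M -> low_price m M n 0 = M.
Proof.
move=> m_gt0 M_gt0; rewrite /low_price mul0r subr0 powRr1 ?divr_ge0 ?ltW //.
by rewrite mulrC divfK // gt_eqF.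
Qed.

Lemma low_pricen (R : realType) (m M : R) (n : nat) :
  (0 < n)%N -> low_price m M n n = m.
Proof.
by move=> n0; rewrite /low_price divff ?pnatr_eq0 -?lt0n // subrr powRr0 mulr1.
Qed.

Lemma low_price_bounds (R : realType) (m M : R) (n j : nat) :
  0 < m -> m < M -> (0 < n)%N -> (j <= n)%N -> m <= low_price m M n j <= M.
Proof.
move=> m_gt0 m_lt_M n_gt0 lejn; have M_gt0 := lt_trans m_gt0 m_lt_M.
have n0 : 0 < n%:R^-1 :> R by rewrite invr_gt0 ltr0n.
have mono i k : (i <= k)%N -> low_price m M n k <= low_price m M n i.
  move=> leik; rewrite ler_pM2l // ler_powR ?(ltW (ratio_gt1 m_gt0 m_lt_M)) //.
  by rewrite lerD2l lerN2 ler_pM2r // ler_nat.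
have := mono 0%N j (leq0n j); have := mono _ _ lejn.
by rewrite low_pricen // low_price0 // => -> ->.
Qed.

(** Consecutive low prices differ by the factor phi^(-1/n), so the product is phi times this factor
    for every [j]. *)
Lemma gain_mul_drop_low_price (R : realType) (m M : R) (n j : nat) :
  0 < m -> 0 < M ->
  M / low_price m M n j * (low_price m M n j.+1 / m)
    = (M / m) `^ (1 - n%:R^-1).
Proof.
move=> m_gt0 M_gt0; have m0 : m != 0 by rewrite gt_eqF.
have r0 : M / m != 0 by rewrite gt_eqF // divr_gt0.
rewrite -{1}(low_price0 n m_gt0 M_gt0) /low_price.
rewrite -mulf_div mulfV // mul1r [m * _]mulrC mulfK //.
rewrite -powRN -!powRD ?r0 ?implybT //.
by congr (_ `^ _); rewrite -natr1; ring.
Qed.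

Lemma zigzag_price_bounds (R : realType) (m M : R) (n i : nat) :
  0 < m -> m < M -> (0 < n)%N -> (i <= n.*2)%N ->
  m <= zigzag_price m M n i <= M.
Proof.
move=> m_gt0 m_lt_M n_gt0 lein; rewrite /zigzag_price.
case: ifP => [odd_i|_]; last by rewrite lexx ltW.
by apply: low_price_bounds => //; rewrite leq_uphalf_double.
Qed.

(** The factor [zigzag_price m M n i / m] is the inverse of the return from buying on day [i] and
    selling at [m]. The last price [x] is arbitrary because OPT is credited only with a trade
    completed before day [i], or with none. *)
Lemma zigzag_price_gain_drop (R : realType) (m M : R) (n i : nat) (x : R) :
  0 < m -> m < M -> (0 < n)%N ->
  (M / m) `^ (1 - n%:R^-1)
    <= opt_return 1 (rcons (mkseq (zigzag_price m M n) i.+1) x)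
       * (zigzag_price m M n i / m).
Proof.
move=> m_gt0 m_lt_M n_gt0; have M_gt0 := lt_trans m_gt0 m_lt_M.
set p := rcons _ x.
have pth l : (l <= i)%N -> p`_l = zigzag_price m M n l.
  by move=> leli; rewrite /p nth_rcons size_mkseq ltnS leli nth_mkseq.
have sp : size p = i.+2 by rewrite size_rcons size_mkseq.
have [odd_i|even_i] := boolP (odd i); last first.
  rewrite /zigzag_price (negbTE even_i) (@le_trans _ _ (M / m)) //.
    by apply: powR_1B_le; rewrite ?(ltW (ratio_gt1 m_gt0 m_lt_M)) ?invr_ge0.
  by rewrite ler_peMl ?opt_return_ge1 // divr_ge0 ?ltW.
have ei : i = (i./2).*2.+1 by rewrite -[LHS]odd_double_half odd_i.
set j := i./2 in ei.
have -> : zigzag_price m M n i = low_price m M n j.+1.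
  by rewrite /zigzag_price odd_i uphalf_half odd_i.
rewrite -(@gain_mul_drop_low_price _ _ _ _ j) // ler_wpM2r //.
  by rewrite divr_ge0 ?mulr_ge0 ?powR_ge0 ?ltW.
(* At the first low price no earlier one exists, and making no trade already gives the required gain
   1. Otherwise OPT buys at the previous low price, on day [i - 2], and sells at [M] the day
   after. *)
case: j ei => [_|j ei].
  by rewrite low_price0 // divff ?gt_eqF // opt_return_ge1.
have lei : (j.*2.+2 <= i)%N by rewrite ei doubleS.
have := @opt_return_ge_gain _ p j.*2.+1 j.*2.+2.
rewrite sp (pth _ lei) (pth _ (ltnW lei)) /zigzag_price /= odd_double /= doubleK.
by apply; rewrite ltnSn ltnS leqW.
Qed.

Lemma zigzag_adversary (R : realType) (m M : R) (n : nat)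
    (A : online_algorithm R) :
  0 < m -> m < M -> (0 < n)%N ->
  exists p : seq R, admissible m M p /\
    (M / m) `^ (1 - n%:R^-1) <= opt_return 1 p / online_return 1 A p.
Proof.
move=> m_gt0 m_lt_M n_gt0; have M_gt0 := lt_trans m_gt0 m_lt_M.
set z := zigzag_price m M n.
have takez l k : (l <= k)%N -> take l (mkseq z k) = mkseq z l.
  by move=> lelk; rewrite /mkseq -map_take take_iota (minn_idPl lelk).
have admz k : (k <= n.*2.+1)%N -> all (fun x => m <= x <= M) (mkseq z k).
  move=> lekn; apply/allP => _ /mapP[i + ->]; rewrite mem_iota add0n => ltik.
  by apply: zigzag_price_bounds => //; rewrite -ltnS (leq_trans ltik).
(* Determinism lets the adversary read off the purchases in advance. Day 2n is left out: it ends the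
   full zigzag, where buying is forbidden. *)
have [buys|nobuy] :=
  pselect (exists i, (i < n.*2)%N && is_buy (A (mkseq z i.+1) false)).
  (* Minimality of [i] makes this the first purchase, hence the only trade. *)
  case: (ex_minnP buys) => i /andP[ltin buy_i] mini.
  exists (rcons (mkseq z i.+1) m); split.
    by rewrite /admissible size_rcons all_rcons lexx (ltW m_lt_M) admz // leqW.
  suff -> : online_return 1 A (rcons (mkseq z i.+1) m) = m / z i.
    by rewrite invf_div; exact: zigzag_price_gain_drop.
  have zS : mkseq z i.+1 = rcons (mkseq z i) (z i).
    by rewrite /mkseq -addn1 iotaD map_cat cats1.
  rewrite zS; apply: online_return_buy_penultimate; last by rewrite -zS.
  move=> l; rewrite size_mkseq => ltli; rewrite takez //; apply/negP => buy_l.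
  have := mini l; rewrite buy_l (ltn_trans ltli ltin) => /(_ isT).
  by rewrite leqNgt ltli.
exists (mkseq z n.*2.+1); split.
  by rewrite /admissible size_mkseq admz.
rewrite online_return_no_buy ?divr1; last first.
  move=> i; rewrite size_mkseq ltnS => ltin; rewrite takez ?leqW //.
  by apply/negP => buy_i; apply: nobuy; exists i; rewrite ltin.
apply: (@le_trans _ _ (M / m)).
  by apply: powR_1B_le; rewrite ?(ltW (ratio_gt1 m_gt0 m_lt_M)) ?invr_ge0.
(* The last two days carry the prices [m] and [M]. *)
have := @opt_return_ge_gain _ (mkseq z n.*2.+1) n.*2.-1 n.*2.
rewrite size_mkseq ltnSn andbT !nth_mkseq ?ltnS ?leq_pred //.
case: n n_gt0 @z {takez admz nobuy} => // n _ z; rewrite doubleS /=.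
rewrite /z /zigzag_price /= odd_double /= doubleK low_pricen //.
by apply.
Qed.

Theorem theorem1 (R : realType) (m M : R) (m_gt0 : 0 < m) (m_lt_M : m < M)
    (eps : R) (eps_gt0 : 0 < eps) (A : online_algorithm R) :
  ((((M / m) `^ (1 - eps))%:E <= competitive_ratio 1 m M A)%E) /\
  (exists p : seq R, admissible m M p /\
     (M / m) `^ (1 - eps) <= opt_return 1 p / online_return 1 A p).
Proof.
have [p [adm_p ratio_p]] : exists p : seq R, admissible m M p /\
    (M / m) `^ (1 - eps) <= opt_return 1 p / online_return 1 A p.
  (* This number of low prices exceeds 1/eps, so its inverse is at most [eps]. *)
  have [p [adm_p ratio_p]] :=
    @zigzag_adversary _ m M (Num.truncn eps^-1).+1 A m_gt0 m_lt_M isT.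
  exists p; split => //; apply: le_trans ratio_p.
  rewrite ler_powR ?(ltW (ratio_gt1 m_gt0 m_lt_M)) // lerD2l lerN2.
  by rewrite invf_ple ?posrE ?ltr0n // ltW // truncnS_gt.
split; last by exists p.
apply: (@le_trans _ _ (opt_return 1 p / online_return 1 A p)%:E).
  by rewrite lee_fin.
by apply: ereal_sup_ubound; exists p.
Qed.
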